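(* Let $G$ be a finite simple graph and let $m\geq 1$ be an integer. Then $d_{\min}(\mathsf{M}_m(G))\geq 1$ if and only if $G$ is not bipartite.
   Context: Graphs are finite, without loops or multiple edges. An orientation is acyclic if it contains no directed cycle. An arc of an acyclic orientation $D$ is dependent if reversing it creates a directed cycle. $d(D)$ is the number of dependent arcs of $D$, and $d_{\min}(G)$ is the minimum of $d(D)$ over all acyclic orientations $D$ of $G$. Generalized Mycielski graph: let $G$ have vertex set $V_0=\{\langle 0,0\rangle,\langle 0,1\rangle,\ldots,\langle 0,n-1\rangle\}$ and edge set $E_0$. For an integer $m>0$, $\mathsf{M}_m(G)$ has vertex set $V_0\cup\bigcup_{i=1}^m V_i\cup\{u\}$, where $V_i=\{\langle i,j\rangle : 0\leq j\leq n-1\}$, and edge set $E_0\cup\bigcup_{i=1}^m E_i\cup\{\langle m,j\rangle u : 0\leq j\leq n-1\}$, where $E_i=\{\langle i-1,j\rangle\langle i,k\rangle : \langle 0,j\rangle\langle 0,k\rangle\in E_0\}$ for $1\leq i\leq m$ (for each edge of $E_0$ both orders of $j,k$ are used). *)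

(* Defs.v *)
From mathcomp Require Import all_boot.

Set Implicit Arguments.
Unset Strict Implicit.
Unset Printing Implicit Defensive.

Record sgraph := SGraph {
  vertex :> finType;
  adj : rel vertex;
  adj_sym : symmetric adj;
  adj_irrefl : irreflexive adj }.

Definition bipartite (G : sgraph) : Prop :=
  exists A : {set G}, forall x y : G, adj x y -> (x \in A) != (y \in A).

Section Digraphs.
Variable V : finType.
Implicit Type D : {set V * V}.

Definition arc D : rel V := fun x y => (x, y) \in D.

(* Directed cycles have pairwise distinct vertices, hence at most #|V| of     *)
(* them; bounding the length makes the predicate boolean.                     *)
Definition has_dicycle D : bool :=
  [exists k : 'I_#|V|.+1, exists c : k.-tuple V, (0 < k) && ucycleb (arc D) c].

Lemma has_dicycleP D :
  reflect (exists2 c : seq V, c != [::] & ucycle (arc D) c) (has_dicycle D).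
Proof.
apply: (iffP existsP) => [[k /existsP[c /andP[k_gt0 cyc_c]]] | [c c_n0 cyc_c]].
  by exists c => //; rewrite -size_eq0 size_tuple -lt0n.
have le_c : size c < #|V|.+1.
  by rewrite ltnS -(card_uniqP (ucycle_uniq cyc_c)) max_card.
exists (Ordinal le_c); apply/existsP; exists (in_tuple c) => /=.
by rewrite lt0n size_eq0 c_n0; exact: cyc_c.
Qed.

Definition reverse_arc D (a : V * V) : {set V * V} :=
  (a.2, a.1) |: (D :\ a).

(* Meaningful when D is acyclic: every directed cycle of reverse_arc D a is   *)
(* then created by the reversal.                                              *)
Definition dependent D (a : V * V) : bool :=
  (a \in D) && has_dicycle (reverse_arc D a).

Definition num_dependent D : nat := #|[set a | dependent D a]|.

End Digraphs.

Section Orientations.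
Variable G : sgraph.
Implicit Type D : {set G * G}.

Definition orientation D : bool :=
  [forall x, forall y,
    (adj x y == arc D x y || arc D y x) && ~~ (arc D x y && arc D y x)].

Definition acyclic_orientation D : bool := orientation D && ~~ has_dicycle D.

Definition rank_orientation : {set G * G} :=
  [set a | adj a.1 a.2 && (enum_rank a.1 < enum_rank a.2)].

Lemma rank_orientation_acyclic : acyclic_orientation rank_orientation.
Proof.
apply/andP; split.
  apply/forallP => x; apply/forallP => y; rewrite /arc !inE /= (adj_sym y x).
  case: (boolP (adj x y)) => //= xy; case: ltngtP => //= /ord_inj/enum_rank_inj.
  by move=> eq_xy; rewrite eq_xy adj_irrefl in xy.
apply/negP => /has_dicycleP[[//|x p] _ /andP[/= cyc _]].
have: path (relpre (fun z : G => nat_of_ord (enum_rank z)) ltn) x (rcons p x).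
  by apply: sub_path cyc => y z; rewrite /arc inE => /andP[].
rewrite (path_sortedE (rev_trans _)) ?all_rcons /= ?ltnn //.
by move=> a b c; exact: (fun h1 h2 => ltn_trans h2 h1).
Qed.

(* The default orientation guarantees that the minimum is attained.           *)
Definition d_min : nat :=
  num_dependent
    [arg min_(D < rank_orientation | acyclic_orientation D) num_dependent D].

Lemma d_minP :
  (exists2 D, acyclic_orientation D & num_dependent D = d_min) /\
  (forall D, acyclic_orientation D -> d_min <= num_dependent D).
Proof.
rewrite /d_min; case: arg_minnP => [|D aD minD].
  exact: rank_orientation_acyclic.
by split=> //; exists D.
Qed.

End Orientations.

Section Mycielski.
Variables (m : nat) (G : sgraph).

(* Some (i, x) is the vertex on level i over x; None is the apex u.           *)
Definition mycielski_adj : rel (option ('I_m.+1 * G)) := fun v w =>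
  match v, w with
  | Some (i, x), Some (j, y) =>
      adj x y && [|| (i == 0 :> nat) && (j == 0 :> nat),
                     j == i.+1 :> nat | i == j.+1 :> nat]
  | Some (i, _), None | None, Some (i, _) => i == m :> nat
  | None, None => false
  end.

Lemma mycielski_adj_sym : symmetric mycielski_adj.
Proof.
move=> [[i x]|] [[j y]|] //=.
by rewrite adj_sym andbC [(_ == 0) && _]andbC [(_ == i.+1) || _]orbC andbC.
Qed.

Lemma mycielski_adj_irrefl : irreflexive mycielski_adj.
Proof. by move=> [[i x]|] //=; rewrite adj_irrefl. Qed.

Definition mycielski : sgraph := SGraph mycielski_adj_sym mycielski_adj_irrefl.

End Mycielski.

(* Main.v *)
Require Import Defs.
From mathcomp Require Import all_boot.
From mathcomp Require Import ssralg ssrnum ssrint intdiv.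
From mathcomp Require Import zify.

(** If [D] is an acyclic orientation without dependent arcs, put
    [w x y = 1] for an arc from [x] to [y] and [w x y = -1] for an arc from
    [y] to [x]; then [w] sums to [0] along every closed walk of length 4.
    Going down from the apex of the Mycielski graph level by level, these
    relations show that [w (i,x) (i+1,y) = P x - Q y] for adjacent [x], [y],
    with [P], [Q] depending on the level.  On level [0], where [w] is also
    antisymmetric, this gives [2 w x y = R x - R y] with [R = P + Q], so [R]
    changes by exactly 2 along each edge of [G], and [R] modulo 4 is a
    bipartition.  Conversely, for a bipartition [A], [B] of [G], direct the
    edges of the Mycielski graph from [A] to [B] and towards the apex; after
    the reversal of any single arc there is still a potential that increases
    strictly along all arcs. *)

Set Implicit Arguments.
Unset Strict Implicit.
Unset Printing Implicit Defensive.

(* [path] also exports a constant [arc]. *)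
Local Notation arc := Defs.arc.

(** * Acyclicity from potentials *)

Lemma potential_acyclic (V : finType) (D : {set V * V}) (g : V -> nat) :
  (forall x y, (x, y) \in D -> g x < g y) -> ~~ has_dicycle D.
Proof.
move=> gD; apply/negP => /has_dicycleP[[//|x p] _ /andP[/= cyc _]].
have: path (relpre g ltn) x (rcons p x) by apply: sub_path cyc => y z /gD.
move/(order_path_min (fun _ _ _ => @ltn_trans _ _ _)).
by rewrite all_rcons /= ltnn.
Qed.

Lemma reverse_arc_potential (V : finType) (D : {set V * V}) (v w : V)
    (g : V -> nat) :
    g w < g v ->
    (forall x y, (x, y) \in D -> (x, y) != (v, w) -> g x < g y) ->
  ~~ dependent D (v, w).
Proof.
move=> gwv gD; rewrite negb_and; apply/orP; right.
apply: (potential_acyclic (g := g)) => x y; rewrite !inE.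
by case/predU1P => [[-> ->] // | /andP[xyN xyD]]; apply: gD.
Qed.

(** * Signs of arcs around 4-cycles *)

Section IndependentOrientation.
Variables (H : sgraph) (D : {set H * H}).
Hypothesis acyD : acyclic_orientation D.
Hypothesis indepD : num_dependent D = 0.

Definition arc_sign (x y : H) : int := if arc D x y then 1%R else (-1)%R.

Let orientD (x y : H) :
  adj x y -> arc D x y || arc D y x /\ ~~ (arc D x y && arc D y x).
Proof.
move=> xy; have /andP[/forallP/(_ x)/forallP/(_ y)/andP[/eqP + ?] _] := acyD.
by rewrite xy => <-.
Qed.

Lemma arc_signN (x y : H) : adj x y -> arc_sign y x = (- arc_sign x y)%R.
Proof. by case/orientD; rewrite /arc_sign; do 2!case: (arc D _ _). Qed.

Let arc_neq (x y : H) : adj x y -> x != y.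
Proof. by apply: contraTneq => ->; rewrite adj_irrefl. Qed.

Lemma no_directed_square (a b c d : H) :
    adj a b -> adj b c -> adj c d -> adj d a -> a != c -> b != d ->
  ~~ [&& arc D a b, arc D b c, arc D c d & arc D d a].
Proof.
move=> /arc_neq ab /arc_neq bc /arc_neq cd /arc_neq da ac bd.
apply/negP => /and4P[Dab Dbc Dcd Dda].
have /andP[_ /negP[]] := acyD; apply/has_dicycleP; exists [:: a; b; c; d] => //.
rewrite /ucycle /= Dab Dbc Dcd Dda /= !inE !negb_or ab bc cd ac bd.
by rewrite eq_sym da.
Qed.

(** Reversing [(a, d)] would close the path [a], [b], [c], [d] to a directed cycle. *)
Lemma no_bypassed_arc (a b c d : H) :
    adj a b -> adj b c -> adj c d -> adj d a -> a != c -> b != d ->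
  ~~ [&& arc D a b, arc D b c, arc D c d & arc D a d].
Proof.
move=> /arc_neq ab /arc_neq bc /arc_neq cd /arc_neq da ac bd.
apply/negP => /and4P[Dab Dbc Dcd Dad].
suff: (a, d) \in [set e | dependent D e] by rewrite (cards0_eq indepD) inE.
rewrite inE /dependent [_ \in D]Dad /=.
apply/has_dicycleP; exists [:: a; b; c; d] => //.
rewrite /ucycle /= /Defs.arc !inE /= !xpair_eqE.
rewrite [(a, b) \in D]Dab [(b, c) \in D]Dbc [(c, d) \in D]Dcd !eqxx.
rewrite (negPf bd) [b == a]eq_sym [c == a]eq_sym (negPf ab) (negPf ac) /=.
by rewrite !orbT /= !negb_or (negPf bc) cd andbT /= eq_sym da.
Qed.

(** In a genuine 4-cycle neither four nor exactly three arcs agree in direction, so two run each way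
    and the signs cancel. If [a = c] or [b = d], the walk retraces its edges. *)
Lemma arc_sign_square (a b c d : H) :
    adj a b -> adj b c -> adj c d -> adj d a ->
  (arc_sign a b + arc_sign b c + arc_sign c d + arc_sign d a = 0)%R.
Proof.
move=> ab bc cd da.
have [<-{c bc cd}|ac] := eqVneq a c.
  by move: ab da; rewrite adj_sym => /arc_signN + /arc_signN; lia.
have [<-{d cd da}|bd] := eqVneq b d.
  by move: ab bc => /arc_signN + /arc_signN; lia.
have ca : c != a by rewrite eq_sym.
have db : d != b by rewrite eq_sym.
have [ba cb dc ad] : [/\ adj b a, adj c b, adj d c & adj a d].
  by split; rewrite adj_sym.
(* Two senses of traversal for a directed square; four starting points in each sense for a bypassed
   arc. *)
have := no_directed_square ab bc cd da ac bd.
have := no_directed_square ad dc cb ba ac db.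
have := no_bypassed_arc ab bc cd da ac bd.
have := no_bypassed_arc bc cd da ab bd ca.
have := no_bypassed_arc cd da ab bc ca db.
have := no_bypassed_arc da ab bc cd db ac.
have := no_bypassed_arc ba ad dc cb bd ac.
have := no_bypassed_arc ad dc cb ba ac db.
have := no_bypassed_arc dc cb ba ad db ca.
have := no_bypassed_arc cb ba ad dc ca bd.
move: (orientD ab) (orientD bc) (orientD cd) (orientD da); rewrite /arc_sign.
case: (arc D a b); case: (arc D b a) => -[] //= _ _;
case: (arc D b c); case: (arc D c b) => -[] //= _ _;
case: (arc D c d); case: (arc D d c) => -[] //= _ _;
by case: (arc D d a); case: (arc D a d) => -[].
Qed.

End IndependentOrientation.

(** * Separation of variables between layers *)

Section MycielskiLayers.
Variables (m : nat) (G : sgraph).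

(* Level 0 is counted twice, so that the edges inside level 0 and the edges
   to the apex both become edges between consecutive layers. *)
Definition layer (k : nat) (x : G) : mycielski m G :=
  if k is k'.+1 then if k' <= m then Some (inord k', x) else None
  else Some (ord0, x).

Lemma layer_adj (k : nat) (x y : G) :
  k <= m.+1 -> adj x y -> adj (layer k x) (layer k.+1 y).
Proof.
case: k => [_ xy|k] /=; first by rewrite xy inordK.
rewrite ltnS => km xy; rewrite km; case: ltnP => [km1|mk] /=.
  by rewrite xy !inordK // eqxx orbT.
by rewrite inordK // eqn_leq km.
Qed.

Lemma layer_separable (w : mycielski m G -> mycielski m G -> int) (k : nat) :
    (forall v v', adj v v' -> w v' v = - w v v')%R ->
    (forall a b c d, adj a b -> adj b c -> adj c d -> adj d a ->
       w a b + w b c + w c d + w d a = 0)%R ->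
    k <= m.+1 ->
  exists P Q : G -> int, forall x y, adj x y ->
    (w (layer k x) (layer k.+1 y) = P x - Q y)%R.
Proof.
move=> wN wsquare le_km; rewrite -(subKn le_km).
elim: (m.+1 - k) => [|r [P [Q wPQ]]].
  (* Layer [m.+2] is the apex alone, so nothing depends on [y]. *)
  rewrite subn0; exists (fun x => w (layer m.+1 x) None), (fun=> 0%R) => x y _.
  by rewrite /= ltnn; lia.
have [lt_rm|le_mr] := ltnP r m.+1; last first.
  have -> : m.+1 - r.+1 = m.+1 - r by lia.
  by exists P, Q.
have : m.+1 - r.+1 < m.+1 by lia.
have Dr : m.+1 - r = (m.+1 - r.+1).+1 by lia.
rewrite {}Dr in wPQ; move: (m.+1 - r.+1) wPQ => j wPQ le_jm.
(* By the square relation below, the sum is the same for every neighbour [x] of [y]. The default [0]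
   only concerns isolated [y]. *)
pose c y := if [pick x | adj x y] is Some x then
  (w (layer j.+1 x) (layer j.+2 y) + w (layer j y) (layer j.+1 x))%R else 0%R.
exists (fun y => c y + Q y)%R, P => y x yx.
have xy : adj x y by rewrite adj_sym.
rewrite /c; case: pickP => [z zy|/(_ x)]; last by rewrite xy.
have yz : adj y z by rewrite adj_sym.
have le_jm' := ltnW le_jm.
have := wsquare (layer j.+1 x) (layer j.+2 y) (layer j.+1 z) (layer j y).
rewrite [adj (layer j.+1 z) _]adj_sym [adj (layer j.+2 y) _]adj_sym.
rewrite !layer_adj // => /(_ isT isT isT isT).
have := wN _ _ (layer_adj le_jm zy); have := wN _ _ (layer_adj le_jm' yz).
by have := wPQ _ _ xy; lia.
Qed.

Lemma independent_mycielski_bipartite (D : {set mycielski m G * mycielski m G}) :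
  acyclic_orientation D -> num_dependent D = 0 -> bipartite G.
Proof.
move=> acyD indepD.
have [P [Q wPQ]] := layer_separable (arc_signN acyD)
  (arc_sign_square acyD indepD) (leq0n m.+1).
pose R x := (P x + Q x)%R; exists [set x | (R x %% 4)%Z \in [:: 0%R; 1%R]].
move=> x y xy; rewrite !inE /R.
have yx : adj y x by rewrite adj_sym.
(* Since layers 0 and 1 coincide, swapping [x] and [y] negates the sign. *)
have l1 z : layer 1 z = layer 0 z by congr (Some (_, _)); apply/val_inj/inordK.
have := arc_signN acyD (layer_adj (leq0n _) xy).
have := wPQ _ _ xy; have := wPQ _ _ yx; rewrite !l1.
have : arc_sign D (layer 0 x) (layer 0 y) = 1%R \/
       arc_sign D (layer 0 x) (layer 0 y) = (-1)%R.
  by rewrite /arc_sign; case: ifP; [left|right].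
by lia.
Qed.

End MycielskiLayers.

(** * An orientation from a bipartition *)

Section BipartiteMycielski.
Variables (m : nat) (G : sgraph) (A : {set G}).
Hypothesis m_gt0 : 0 < m.
Hypothesis bipA : forall x y : G, adj x y -> (x \in A) != (y \in A).

Definition height (v : mycielski m G) : nat :=
  if v is Some (_, x) then x \notin A else 2.

Definition height_orientation : {set mycielski m G * mycielski m G} :=
  [set a | adj a.1 a.2 && (height a.1 < height a.2)].

Lemma height_orientation_acyclic : acyclic_orientation height_orientation.
Proof.
apply/andP; split; last first.
  by apply: (potential_acyclic (g := height)) => v w; rewrite inE => /andP[].
apply/forallP => v; apply/forallP => w; rewrite /Defs.arc !inE /= (mycielski_adj_sym w).
case: (boolP (mycielski_adj v w)) => //= vw; suff: height v != height w by case: ltngtP.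
move: v w vw => [[i x]|] [[j y]|] //=.
- by case/andP=> /bipA; do 2!case: (_ \in A).
- by case: (x \in A).
- by case: (y \in A).
Qed.

Lemma height_orientation_independent : num_dependent height_orientation = 0.
Proof.
apply/eqP; rewrite cards_eq0; apply/eqP/setP => -[v w]; rewrite [RHS]inE inE.
apply/negbTE; have [|] := boolP ((v, w) \in height_orientation); last first.
  by rewrite /dependent => /negPf->.
rewrite inE /= => /andP[]; case: v => [[i x]|]; last first.
  by case: w => [[j y]|] //=; case: (y \in A).
case: w => [[j y]|].
  move=> /= /andP[xy _]; have := bipA xy.
  case: (boolP (x \in A)); case: (boolP (y \in A)) => //= yA xA _ _.
  (* The two ends of the reversed arc fit between the rest of [A] at 0 and the rest of its
     complement at 3. *)
  apply: (reverse_arc_potential (g := fun v : mycielski m G =>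
    if v is Some (k, z) then
      if z \in A then if (k, z) == (i, x) then 2 else 0
      else if (k, z) == (j, y) then 1 else 3
    else 4)); first by rewrite /= xA (negPf yA) !eqxx.
  move=> [[k z]|] [[l t]|]; rewrite inE //=.
  - case/andP=> _; case: (z \in A) (t \in A) => [] [] //= _.
    rewrite xpair_eqE !(inj_eq Some_inj).
    by do 2!case: ((_, _) == _).
  - by move=> _ _; case: (z \in A); case: ((_, _) == _).
  - by case: (t \in A); rewrite /= andbF.
rewrite /= => /eqP im _.
(* The apex drops below [(i, x)] but stays above the rest of level [m]. *)
apply: (reverse_arc_potential (g := fun v : mycielski m G =>
  if v is Some (k, z) then
    if (k, z) == (i, x) then 3 else
    if z \in A then 0 else if k == m :> nat then 1 else 4
  else 2)); first by rewrite /= eqxx.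
move=> [[k z]|] [[l t]|]; rewrite inE //= xpair_eqE.
- case: ((k, z) =P (i, x)) => [[-> ->]|_] /=; last first.
    case/andP=> _; case: (z \in A) (t \in A) => [] [] //= _ _.
    by case: ifP; last case: ifP.
  case: ((l, t) =P (i, x)) => [[-> ->]|_]; first by rewrite ltnn andbF.
  (* As [m > 0], level [m] spans no edge, so this head lies below level [m] and has value 4. *)
  rewrite im eqn0Ngt m_gt0 => /andP[/andP[_ il]].
  case: (x \in A) (t \in A) => [] [] //= _ _.
  by case: eqP => // lm; move: il; rewrite lm; lia.
- case/andP=> /eqP-> _ /negPf; rewrite andbT (inj_eq Some_inj) => ->.
  by rewrite eqxx; case: ifP.
- by case: (t \in A); rewrite /= andbF.
Qed.

End BipartiteMycielski.

Theorem theorem6 (G : sgraph) (m : nat) (hm : 0 < m) :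
  1 <= d_min (mycielski m G) <-> ~ bipartite G.
Proof.
have [[D acyD dD] minD] := d_minP (mycielski m G); split.
  move=> + [A bipA]; apply/negP; rewrite -leqNgt.
  rewrite -(height_orientation_independent hm bipA).
  exact/minD/height_orientation_acyclic.
rewrite lt0n => notbip; apply: contra_notN notbip => /eqP d0.
by apply: (independent_mycielski_bipartite acyD); rewrite dD.
Qed.
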